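(* Let $\mathcal{M}$ be a differentiable submanifold of $\mathbb{R}^n$ such that at almost every point of $\mathcal{M}$ the tangent plane is not orthogonal to any of the coordinate axes. Then for every $\boldsymbol\theta\in\mathbb{R}^n$ and almost every $\mathbf{x}\in\mathcal{M}$, $$\omega_0^\times(\mathbf{x},\boldsymbol\theta)\ge\frac{1-(n-1)\omega_0^\times(\mathcal{M})}{n\,\omega_0^\times(\mathcal{M})},$$ and for every $\theta\in\mathbb{R}$ and almost every $\mathbf{x}\in\mathcal{M}$, $$\omega_{n-1}^\times(\mathbf{x},\theta)\ge\frac{n}{\omega_{n-1}^\times(\mathcal{M})-(n-1)}.$$
   Context: For $y\in\mathbb{R}$, $\langle y\rangle$ is the unique number in $[-1/2,1/2)$ congruent to $y$ mod $\mathbb{Z}$. For $\mathbf{x},\boldsymbol\theta\in\mathbb{R}^n$, $\omega_0^\times(\mathbf{x},\boldsymbol\theta)$ is the supremum of $w\ge0$ such that for arbitrarily large $Q>1$ there is nonzero $q\in\mathbb{Z}$ with $\prod_{j=1}^n|\langle qx_j+\theta_j\rangle|<Q^{-nw}$ and $\max\{1,|q|\}\le Q$. For $\mathbf{x}\in\mathbb{R}^n$, $\theta\in\mathbb{R}$, $\omega_{n-1}^\times(\mathbf{x},\theta)$ is the supremum of $w\ge0$ such that for arbitrarily large $Q>1$ there is nonzero $\mathbf{q}\in\mathbb{Z}^n$ with $|\langle\mathbf{q}\cdot\mathbf{x}+\theta\rangle|<Q^{-w}$ and $\prod_{i=1}^n\max\{1,|q_i|\}\le Q^n$. Homogeneous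 exponents are the values at zero shift. If $\mathcal{M}$ is parametrised by $f:U\to\mathbb{R}^n$ and $\mu=f_*\lambda$, then $\omega_0^\times(\mathcal{M})=\sup\{v:\mu\{\mathbf{x}:\omega_0^\times(\mathbf{x})>v\}>0\}$, similarly $\omega_{n-1}^\times(\mathcal{M})$; ''almost every'' on $\mathcal{M}$ is with respect to $\mu$. *)

(* Defs.v *)
From HB Require Import structures.
From mathcomp Require Import all_boot all_order all_algebra.
From mathcomp Require Import all_classical all_reals all_analysis.

Set Implicit Arguments.
Unset Strict Implicit.
Unset Printing Implicit Defensive.

Import Order.TTheory GRing.Theory Num.Theory.
Import numFieldNormedType.Exports.

Local Open Scope classical_set_scope.
Local Open Scope ring_scope.

Definition dot (R : realType) n (x y : 'rV[R]_n) : R :=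
  \sum_(i < n) x ord0 i * y ord0 i.

(* The representative of y mod Z in [-1/2, 1/2[; see centered_uniq. *)
Definition centered (R : realType) (y : R) : R :=
  y - (Num.floor (y + 2^-1))%:~R.

Lemma centered_itv (R : realType) (y : R) :
  - 2^-1 <= centered y < 2^-1.
Proof.
have /andP[h1 h2] := floor_itv (y + 2^-1).
rewrite /centered; apply/andP; split.
  by rewrite lerBrDr addrC lerBlDr.
rewrite ltrBlDr; move: h2; rewrite intrD -(ltrD2r (- 2^-1)) addrK => h2.
apply: (lt_le_trans h2); rewrite -addrA addrC lerD2r.
by rewrite lerBlDr -mulr2n -(mulr_natr 2^-1 2) mulVf ?pnatr_eq0.
Qed.

Lemma centered_uniq (R : realType) (y z : R) :
  - 2^-1 <= z < 2^-1 -> (exists m : int, y - z = m%:~R) -> centered y = z.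
Proof.
move=> /andP[z1 z2] [m ym].
have yE : y = m%:~R + z by rewrite -ym subrK.
have fE : Num.floor (y + 2^-1) = m.
  apply/eqP; rewrite -[_ == m]andTb floor_eq ?num_real //= yE.
  rewrite -addrA lerDl -lerBlDr sub0r z1 /= intrD ltrD2l mulr1z.
  have h : (2^-1 + 2^-1 : R) = 1.
    by rewrite -mulr2n -(mulr_natr 2^-1 2) mulVf ?pnatr_eq0.
  by rewrite -[ltRHS]h ltrD2r.
by rewrite /centered fE yE addrC addKr.
Qed.

(* omega_0^x(x, theta), in \bar R since it may be infinite. *)
Definition omega0 (R : realType) n (x theta : 'rV[R]_n) : \bar R :=
  ereal_sup [set w%:E | w in [set w : R | 0 <= w /\
    forall Q0 : R, exists Q : R, [/\ Q0 < Q, 1 < Q &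
      exists q : int, [/\ q != 0,
        \prod_(j < n) `|centered (q%:~R * x ord0 j + theta ord0 j)|
          < Q `^ (- (n%:R * w)) &
        Num.max 1 `|q%:~R| <= Q]]]].

(* omega_{n-1}^x(x, theta) *)
Definition omega_dual (R : realType) n (x : 'rV[R]_n) (theta : R) : \bar R :=
  ereal_sup [set w%:E | w in [set w : R | 0 <= w /\
    forall Q0 : R, exists Q : R, [/\ Q0 < Q, 1 < Q &
      exists q : 'rV[int]_n, [/\ q != 0,
        `|centered (dot (map_mx intr q) x + theta)| < Q `^ (- w) &
        \prod_(i < n) Num.max 1 `|(q ord0 i)%:~R| <= Q ^+ n]]]].

(* Lebesgue measure on R^d (for 0 < d), extended to all subsets as the
   Lebesgue outer measure: infimum of the total volume of countable covers by
   closed boxes, a box being empty as soon as a_j > b_j for some j. *)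
Definition box (R : realType) d (a b : 'rV[R]_d) : set 'rV[R]_d :=
  [set u | forall j, a ord0 j <= u ord0 j <= b ord0 j].

Definition box_volume (R : realType) d (a b : 'rV[R]_d) : R :=
  \prod_(j < d) Num.max 0 (b ord0 j - a ord0 j).

Definition lebesgue_rV (R : realType) d (A : set 'rV[R]_d) : \bar R :=
  ereal_inf [set (\sum_(0 <= k <oo) (box_volume (c k).1 (c k).2)%:E)%E |
    c in [set c : nat -> 'rV[R]_d * 'rV[R]_d |
      A `<=` \bigcup_k box (c k).1 (c k).2]].

(* f : U -> R^n parametrises the d-dimensional embedded submanifold f @` U:
   a differentiable immersion on the open set U which is a homeomorphism onto
   its image. *)
Definition parametrises_submanifold (R : realType) d n
    (U : set 'rV[R]_d) (f : 'rV[R]_d -> 'rV[R]_n) : Prop :=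
  [/\ open U,
      forall u, U u -> differentiable f u,
      forall u, U u -> injective ('d f u),
      {in U &, injective f} &
      forall V, open V -> V `<=` U ->
        exists2 W : set 'rV[R]_n, open W & f @` V = (f @` U) `&` W].

Definition tangent_plane (R : realType) d n
    (U : set 'rV[R]_d) (f : 'rV[R]_d -> 'rV[R]_n) (x : 'rV[R]_n) :
    set 'rV[R]_n :=
  [set w | exists u v, [/\ U u, f u = x & w = 'd f u v]].

(* T is orthogonal to the j-th coordinate axis. *)
Definition orthogonal_to_axis (R : realType) n (T : set 'rV[R]_n) (j : 'I_n) :
    Prop :=
  forall w, T w -> dot w (delta_mx ord0 j) = 0.

(* The measure mu = f_* lambda, lambda being Lebesgue measure on U. *)
Definition param_measure (R : realType) d n
    (U : set 'rV[R]_d) (f : 'rV[R]_d -> 'rV[R]_n) (A : set 'rV[R]_n) : \bar R :=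
  lebesgue_rV (U `&` f @^-1` A).

Definition almost_every (R : realType) n (mu : set 'rV[R]_n -> \bar R)
    (P : 'rV[R]_n -> Prop) : Prop :=
  mu [set x | ~ P x] = 0%E.

Definition manifold_exponent (R : realType) n (mu : set 'rV[R]_n -> \bar R)
    (omega : 'rV[R]_n -> \bar R) : \bar R :=
  ereal_sup [set v%:E | v in
    [set v : R | (0 < mu [set x | v%:E < omega x])%E]].

(* Main.v *)
Require Import Defs.
From HB Require Import structures.
From mathcomp Require Import all_boot all_order all_algebra.
From mathcomp Require Import all_classical all_reals all_analysis.
From mathcomp Require Import lra ring zify.

(* The transference holds for every x separately: if omega(x) <= w, the
   inhomogeneous exponent of x is at least the bound attached to w, whatever
   the shift.  For real A, when the box |q_i| < Q, |(qA - p)_j| < 1/m contains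
   no nonzero integer point (q, p), a packing argument on the torus shows that
   dilating it by a factor O(m^b / Q^a) makes it meet every translated lattice;
   with 1/m of order Q^(-v), v slightly above w, this is an inhomogeneous
   solution of the required quality, because a box inside the domains defining
   the multiplicative exponents is all that the hypothesis on w has to exclude.
   It applies with A = x (a = 1) for omega_0 and A = x^T (b = 1) for
   omega_{n-1}.  Finally omega(x) <= omega(M) off a countable union of null
   sets. *)

Set Implicit Arguments.
Unset Strict Implicit.

Import Order.TTheory GRing.Theory Num.Theory.
Import numFieldNormedType.Exports.

Local Open Scope classical_set_scope.
Local Open Scope ring_scope.

(** * Integers near a real number and cells of the circle *)

Lemma centered_le (R : realType) (y : R) (p : int) :
  `|centered y| <= `|y - p%:~R|.
Proof.
have /andP[c1 c2] := centered_itv y.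
have -> : y - p%:~R = centered y + (Num.floor (y + 2^-1) - p)%:~R.
  by rewrite /centered intrB; ring.
move: (_ - p) => k; move: (centered y) c1 c2 => c c1 c2.
(* For [k] nonzero, [|c + k| >= 1/2 >= |c|]. *)
case: (ltgtP k 0) => [k0|k0|->]; last by rewrite addr0.
- have : k%:~R <= -1 :> R by rewrite -(@intrN R 1) ler_int; lia.
  move: (k%:~R) => z z1; rewrite [leRHS]ler0_norm ?ler_norml; lra.
- have : 1 <= k%:~R :> R by rewrite (@ler_int R 1); lia.
  move: (k%:~R) => z z1; rewrite [leRHS]ger0_norm ?ler_norml; lra.
Qed.

Lemma centered_ex (R : realType) (y : R) : exists p : int, centered y = y - p%:~R.
Proof. by exists (Num.floor (y + 2^-1)). Qed.

Lemma fractional_cell (R : realType) (m : nat) (y : R) : (0 < m)%N ->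
  exists (p : int) (c : 'I_m), c%:R <= m%:R * (y - p%:~R) < c%:R + 1.
Proof.
move=> m0; exists (Num.floor y).
have /andP[f1 f2] := floor_itv y; rewrite intrD in f2.
have m0R : 0 < m%:R :> R by rewrite ltr0n.
have t0 : 0 <= m%:R * (y - (Num.floor y)%:~R) by rewrite mulr_ge0 ?subr_ge0.
have /andP[h1 h2] := truncn_itv t0.
have h3 : (Num.truncn (m%:R * (y - (Num.floor y)%:~R)) < m)%N.
  rewrite -(ltr_nat R) (le_lt_trans h1)// -[ltRHS]mulr1 ltr_pM2l//; lra.
by exists (Ordinal h3); rewrite /= h1 /= natr1.
Qed.

(** * Pigeonhole on the torus *)

(** There are [K * Q^a] pairs [(k, r)]. The integer vector [q] moves [u k] into the unit cell of
    [[0, Q[^a] with corner [r], and [Y] modulo 1 lies in one of [m^b] cells of side [1/m]. Two pairs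
    share a cell, and their difference is the required point; if [k = l], they differ in [r], whence
    [q != 0]. *)
Lemma lattice_pigeonhole (R : realType) (a b K Q m : nat) (A : 'M[R]_(a, b))
    (u : 'I_K -> 'rV[R]_a) (y : 'I_K -> 'rV[R]_b) :
  (0 < m)%N -> (m ^ b < K * Q ^ a)%N ->
  exists (k l : 'I_K) (q : 'rV[int]_a) (p : 'rV[int]_b),
    [/\ (k != l) || (q != 0),
        forall i, `|u k ord0 i - u l ord0 i + (q ord0 i)%:~R| < Q%:R &
        forall j, `|y k ord0 j - y l ord0 j + (map_mx intr q *m A) ord0 j
                    - (p ord0 j)%:~R| < m%:R^-1].
Proof.
move=> m0 mKQ.
pose q (kr : 'I_K * {ffun 'I_a -> 'I_Q}) : 'rV[int]_a :=
  \row_i ((kr.2 i)%:Z - Num.floor (u kr.1 ord0 i)).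
pose Y kr := y kr.1 + map_mx intr (q kr) *m A.
have /choice[g gP] : forall kr, exists pc : 'rV[int]_b * {ffun 'I_b -> 'I_m},
    forall j, (pc.2 j)%:R <= m%:R * (Y kr ord0 j - (pc.1 ord0 j)%:~R)
              < (pc.2 j)%:R + 1.
  move=> kr.
  have /choice[h hP] : forall j, exists pc : int * 'I_m,
      (pc.2)%:R <= m%:R * (Y kr ord0 j - (pc.1)%:~R) < (pc.2)%:R + 1.
    by move=> j; have [p [c pc]] := fractional_cell (Y kr ord0 j) m0; exists (p, c).
  exists (\row_j (h j).1, [ffun j => (h j).2]) => j /=.
  by rewrite mxE ffunE; exact: hP.
have /injectivePn[[k r] [[l r'] neq]] : ~~ injectiveb (fun kr => (g kr).2).
  apply/negP => /injectiveP/leq_card.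
  by rewrite card_prod !card_ffun !card_ord leqNgt mKQ.
have := gP (k, r); have := gP (l, r').
case: (g (k, r)) (g (l, r')) => [p c] [p' c'] /= gl gk cc.
exists k, l, (q (k, r) - q (l, r')), (p - p'); split.
- rewrite -implybE; apply/implyP => /eqP kl; subst l.
  apply: contraNneq neq; rewrite /q => /= /rowP qq.
  apply/eqP; congr (_, _); apply/ffunP => i; apply: val_inj => /=.
  by have := qq i; rewrite !mxE => /eqP; rewrite subr_eq0 => /eqP; lia.
- move=> i; rewrite !mxE /= rmorphB /= !rmorphB /=.
  have /andP[] := floor_itv (u k ord0 i); have /andP[] := floor_itv (u l ord0 i).
  rewrite !intrD -!pmulrn.
  have : (r i)%:R + 1 <= Q%:R :> R by rewrite natr1 ler_nat.
  have : (r' i)%:R + 1 <= Q%:R :> R by rewrite natr1 ler_nat.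
  have : 0 <= (r i)%:R :> R by [].
  have : 0 <= (r' i)%:R :> R by [].
  rewrite ltr_norml => *; lra.
- move=> j; rewrite map_mxB mulmxBl.
  have := gl j; have := gk j; rewrite cc /Y /= !mxE rmorphB /=.
  have m0R : 0 < m%:R :> R by rewrite ltr0n.
  move=> /andP[k1 k2] /andP[l1 l2].
  rewrite -[ltRHS]mul1r ltr_pdivlMr// -[X in _ * X](gtr0_norm m0R) -normrM ltr_norml.
  by apply/andP; split; lra.
Qed.

(** Dirichlet's theorem for a system of linear forms: the pigeonhole with [K = 1], where [k = l] is
    forced and hence [q != 0]. *)
Lemma exists_small_multiple (R : realType) (a b Q m : nat) (A : 'M[R]_(a, b)) :
  (0 < m)%N -> (m ^ b < Q ^ a)%N ->
  exists q : 'rV[int]_a, [/\ q != 0,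
    forall i, `|(q ord0 i)%:~R : R| < Q%:R &
    forall j, `|centered ((map_mx intr q *m A) ord0 j)| < m%:R^-1].
Proof.
move=> m0 mQ; rewrite -[X in (_ < X)%N]mul1n in mQ.
have [k [l [q [p [nz hq hp]]]]] :=
  lattice_pigeonhole A (fun=> 0) (fun=> 0) m0 mQ.
exists q; split.
- by move: nz; rewrite (ord1 k) (ord1 l) eqxx.
- by move=> i; have := hq i; rewrite subrr add0r.
- move=> j; apply: le_lt_trans (centered_le _ (p ord0 j)) _.
  by have := hp j; rewrite subrr add0r.
Qed.

(** * From the absence of homogeneous solutions to inhomogeneous ones *)

Lemma inhomogeneous_box (R : realType) (a b K Q m : nat) (A : 'M[R]_(a, b)) :
  (0 < m)%N -> (0 < K)%N -> (0 < Q)%N -> (m ^ b < K * Q ^ a)%N ->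
  (forall q : 'rV[int]_a, q != 0 -> (forall i, `|(q ord0 i)%:~R : R| < Q%:R) ->
     exists j, m%:R^-1 <= `|centered ((map_mx intr q *m A) ord0 j)|) ->
  forall theta : 'rV[R]_b, exists q : 'rV[int]_a,
    (forall i, `|(q ord0 i)%:~R : R| < (2 * K)%:R * Q%:R) /\
    (forall j, `|centered ((map_mx intr q *m A + theta) ord0 j)|
                 < (2 * K)%:R / m%:R).
Proof.
move=> m0 K0 Q0 mKQ hom theta.
have m0R : 0 < m%:R :> R by rewrite ltr0n.
have Q0R : 0 < Q%:R :> R by rewrite ltr0n.
have K0R : 0 < K%:R :> R by rewrite ltr0n.
(* [inbox t]: the box dilated by [t] meets the lattice of points [(q, qA - p)] shifted by
   [(0, theta)]. Only natural [t] are compared, so that a least one exists. *)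
pose inbox (t : R) := exists (q : 'rV[int]_a) (p : 'rV[int]_b),
  (forall i, `|(q ord0 i)%:~R : R| < t * Q%:R) /\
  (forall j, `|(map_mx intr q *m A + theta) ord0 j - (p ord0 j)%:~R| < t / m%:R).
have [i0 i0P i0min] : exists2 i : nat, inbox i%:R &
    forall k : nat, inbox k%:R -> (i <= k)%N.
  have exi : exists i : nat, `[< inbox i%:R >].
    (* With [q = p = 0], a dilation above every [m |theta_j|] suffices; the sum bounds them all. *)
    exists (Num.trunc (\sum_j `|theta ord0 j| * m%:R)).+1; apply/asboolP.
    exists 0, 0; split=> [i|j]; first by rewrite mxE normr0 mulr_gt0.
    rewrite map_mx0 mul0mx !mxE subr0 add0r ltr_pdivlMr//.
    apply: le_lt_trans (truncnS_gt _).
    by rewrite (bigD1 j)//= lerDl sumr_ge0// => *; rewrite mulr_ge0.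
  case: (ex_minnP exi) => i /asboolP Pi mi; exists i => // k Pk.
  by apply: mi; apply/asboolP.
(* Suppose the least dilation i0 exceeds 2K, attained at (u, y).  Comparing the
   K points (k/K)(u, y) by the pigeonhole puts some t(u, y) + z, with z in the
   lattice and t >= 1/K, in the unit box; then (u, y) + z lies in the box of
   dilation (1 - t) i0 + 1 <= i0 - 1. *)
suff i02K : (i0 <= 2 * K)%N.
  have [q [p [hq hp]]] := i0P; exists q; split => [i|j].
    by apply: lt_le_trans (hq i) _; rewrite ler_pM2r// ler_nat.
  apply: le_lt_trans (centered_le _ (p ord0 j)) _.
  by apply: lt_le_trans (hp j) _; rewrite ler_pM2r ?invr_gt0// ler_nat.
rewrite leqNgt; apply/negP => i0K.
have [u [p [hu hp]]] := i0P.
pose y j := (map_mx intr u *m A + theta) ord0 j - (p ord0 j)%:~R.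
have [t [q [r [t0 t1 hq hr]]]] : exists (t : R) (q : 'rV[int]_a) (r : 'rV[int]_b),
  [/\ K%:R^-1 <= t, t < 1,
      forall i, `|t * (u ord0 i)%:~R + (q ord0 i)%:~R| < Q%:R &
      forall j, `|t * y j + (map_mx intr q *m A) ord0 j - (r ord0 j)%:~R| < m%:R^-1].
  have [k [l [q [r [kl hq hr]]]]] := lattice_pigeonhole A
    (fun k : 'I_K => \row_i (k%:R / K%:R * (u ord0 i)%:~R))
    (fun k : 'I_K => \row_j (k%:R / K%:R * y j)) m0 mKQ.
  (* The sign of the difference is chosen so that [t = |k - l| / K] is positive; [k = l] contradicts
     [hom]. *)
  have [lt_kl|lt_lk|eq_kl] := ltngtP k l.
  - exists ((l%:R - k%:R) / K%:R), (- q), (- r).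
    split.
    + by rewrite ler_pdivlMr// mulVf ?gt_eqF// -natrB ?(ltnW lt_kl)// ler1n subn_gt0.
    + rewrite ltr_pdivrMr// mul1r -natrB ?(ltnW lt_kl)// ltr_nat.
      by rewrite (leq_ltn_trans (leq_subr _ _)).
    + move=> i; move: (hq i); rewrite -normrN !mxE rmorphN /=; congr (`|_| < _).
      by ring.
    + move=> j; move: (hr j); rewrite map_mxN mulNmx -normrN.
      rewrite !mxE rmorphN /=; congr (`|_| < _).
      by ring.
  - exists ((k%:R - l%:R) / K%:R), q, r.
    split.
    + by rewrite ler_pdivlMr// mulVf ?gt_eqF// -natrB ?(ltnW lt_lk)// ler1n subn_gt0.
    + rewrite ltr_pdivrMr// mul1r -natrB ?(ltnW lt_lk)// ltr_nat.
      by rewrite (leq_ltn_trans (leq_subr _ _)).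
    + move=> i; move: (hq i); rewrite !mxE; congr (`|_| < _).
      by ring.
    + move=> j; move: (hr j).
      rewrite !mxE; congr (`|_| < _).
      by ring.
  - have {}eq_kl : k = l by exact: val_inj.
    move: kl hq hr; rewrite eq_kl eqxx /= => qn0 hq hr.
    have [i|j] := hom q qn0; first by have := hq i; rewrite subrr add0r.
    rewrite leNgt => /negP[]; apply: le_lt_trans (centered_le _ (r ord0 j)) _.
    by have := hr j; rewrite subrr add0r.
have i0R : 2 * K%:R + 1 <= i0%:R :> R by rewrite -natrM natr1 ler_nat.
(* Shrinking by [1 - t] thus gains at least 2, of which adding a point of the unit box takes back
   1. *)
have ti0 : 2 <= t * i0%:R.
  rewrite (le_trans _ (ler_wpM2r _ t0))// ler_pdivlMl//; lra.
suff /i0min : inbox i0.-1%:R by lia.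
have -> : i0.-1%:R = i0%:R - 1 :> R by rewrite -(natrB _ (_ : 1 <= i0)%N) ?subn1//; lia.
exists (u + q), (p + r); split=> [i|j].
  rewrite mxE rmorphD /=.
  have -> : (u ord0 i)%:~R + (q ord0 i)%:~R = (1 - t) * (u ord0 i)%:~R
      + (t * (u ord0 i)%:~R + (q ord0 i)%:~R) :> R by ring.
  rewrite (le_lt_trans (ler_normD _ _))//.
  have h : `|(1 - t) * (u ord0 i)%:~R| <= (1 - t) * (i0%:R * Q%:R).
    by rewrite normrM ger0_norm ?subr_ge0 ?(ltW t1)// ler_wpM2l ?subr_ge0 ?(ltW t1)// ltW.
  have := hq i; have : 2 * Q%:R <= t * i0%:R * Q%:R by rewrite ler_wpM2r// ltW.
  lra.
have -> : (map_mx intr (u + q) *m A + theta) ord0 j - ((p + r) ord0 j)%:~R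
   = (1 - t) * y j + (t * y j + (map_mx intr q *m A) ord0 j - (r ord0 j)%:~R).
  by rewrite map_mxD mulmxDl /y !mxE rmorphD /=; ring.
rewrite (le_lt_trans (ler_normD _ _))//.
have h : `|(1 - t) * y j| <= (1 - t) * (i0%:R / m%:R).
  rewrite normrM ger0_norm ?subr_ge0 ?(ltW t1)// ler_wpM2l ?subr_ge0 ?(ltW t1)//.
  exact/ltW/hp.
have := hr j; have : 2 * m%:R^-1 <= t * i0%:R * m%:R^-1 by rewrite ler_wpM2r// invr_ge0 ltW.
lra.
Qed.

(** The exponents count only nonzero [q]; securing this costs a doubling of the dilation. *)
Lemma inhomogeneous_box_neq0 (R : realType) (a b K Q m : nat) (A : 'M[R]_(a, b)) :
  (0 < a)%N -> (0 < m)%N -> (0 < K)%N -> (0 < Q)%N -> (m ^ b < K * Q ^ a)%N ->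
  (forall q : 'rV[int]_a, q != 0 -> (forall i, `|(q ord0 i)%:~R : R| < Q%:R) ->
     exists j, m%:R^-1 <= `|centered ((map_mx intr q *m A) ord0 j)|) ->
  forall theta : 'rV[R]_b, exists q : 'rV[int]_a,
    [/\ q != 0, forall i, `|(q ord0 i)%:~R : R| < (4 * K)%:R * Q%:R &
      forall j, `|centered ((map_mx intr q *m A + theta) ord0 j)|
                 < (4 * K)%:R / m%:R].
Proof.
move=> a0 m0 K0 Q0 mKQ hom theta.
have m0R : 0 < m%:R :> R by rewrite ltr0n.
have Q0R : 0 < Q%:R :> R by rewrite ltr0n.
have K0R : 1 <= K%:R :> R by rewrite ler1n.
have m1 : 0 < m%:R^-1 :> R by rewrite invr_gt0.
have [q [hq hy]] := inhomogeneous_box m0 K0 Q0 mKQ hom theta.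
(* A solution with q = 0 is corrected by adding a nonzero homogeneous one. *)
have [q0|qn0] := eqVneq q 0; last first.
  exists q; split=> // [i|j].
    by apply: lt_le_trans (hq i) _; rewrite ler_pM2r// ler_nat leq_mul2r orbT.
  by apply: lt_le_trans (hy j) _; rewrite ler_pM2r// ler_nat leq_mul2r orbT.
(* Since [a > 0], [K <= (2K)^a], so Dirichlet's theorem applies to the box of size [2KQ]. *)
have mKQ' : (m ^ b < (2 * K * Q) ^ a)%N.
  apply: (leq_trans mKQ); rewrite expnMn leq_mul2r expn_eq0 eqn0Ngt Q0/=.
  by rewrite -[X in (X <= _)%N]expn1 (@leq_trans ((2 * K) ^ 1))// ?leq_pexp2l//; lia.
have [q' [q'0 hq' hy']] := exists_small_multiple A m0 mKQ'.
exists q'; split=> // [i|j].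
  apply: lt_le_trans (hq' i) _; rewrite natrM ler_pM2r// ler_nat leq_mul2r orbT//.
have [p pE] := centered_ex ((map_mx intr q' *m A) ord0 j).
have [p' p'E] := centered_ex ((map_mx intr q *m A + theta) ord0 j).
apply: le_lt_trans (centered_le _ (p + p')) _.
have -> : (map_mx intr q' *m A + theta) ord0 j - (p + p')%:~R =
   centered ((map_mx intr q' *m A) ord0 j) +
   centered ((map_mx intr q *m A + theta) ord0 j).
  by rewrite pE p'E q0 map_mx0 mul0mx !mxE rmorphD /=; ring.
rewrite (le_lt_trans (ler_normD _ _))//.
have := hy' j; have := hy j.
have : 1 * m%:R^-1 <= K%:R * m%:R^-1 :> R by rewrite ler_wpM2r// ltW.
rewrite !natrM; lra.
Qed.

(** * From boxes to exponents *)

Lemma powR_unbounded (R : realType) (e B : R) : 0 < e ->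
  exists N : nat, forall Q : nat, (N <= Q)%N -> B < Q%:R `^ e.
Proof.
move=> e0; exists (Num.trunc ((`|B| + 1) `^ e^-1)).+1 => Q NQ.
have hQ : (`|B| + 1) `^ e^-1 < Q%:R.
  by apply: lt_le_trans (truncnS_gt _) _; rewrite ler_nat.
have := gt0_ltr_powR e0 (_ : _ \is Num.nneg) (_ : _ \is Num.nneg) hQ.
rewrite -powRrM mulVf ?gt_eqF// powRr1 ?addr_ge0// !nnegrE powR_ge0 ler0n.
move=> /(_ isT isT); apply: le_lt_trans.
by rewrite (le_trans (ler_norm B))// lerDl.
Qed.

(** With [m] of order [Q^v], the factor [K] has order [Q^(b v - a)]. The solutions then have size
    [X] of order [Q^al] and error [K/m] of order [Q^(b v - a - v)]. The condition on [s] makes this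
    error smaller than [X^(-s)] with a power of [Q] to spare, and [al > 0] makes [X] unbounded. *)
Lemma inhomogeneous_exponent (R : realType) (a b : nat) (A : 'M[R]_(a, b))
    (v s Q1 : R) :
  (0 < a)%N -> 0 <= v -> 0 <= s -> 0 < b%:R * v - a%:R + 1 ->
  s * (b%:R * v - a%:R + 1) < v + a%:R - b%:R * v ->
  (forall Q : nat, Q1 < Q%:R -> forall q : 'rV[int]_a, q != 0 ->
     (forall i, `|(q ord0 i)%:~R : R| < Q%:R) ->
     exists j, Q%:R `^ (- v) <= `|centered ((map_mx intr q *m A) ord0 j)|) ->
  forall (theta : 'rV[R]_b) (X0 : R), exists X : R, [/\ X0 < X, 1 < X &
    exists q : 'rV[int]_a, [/\ q != 0, forall i, `|(q ord0 i)%:~R : R| <= X &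
      forall j, `|centered ((map_mx intr q *m A + theta) ord0 j)| < X `^ (- s)]].
Proof.
set al := b%:R * v - a%:R + 1 => a0 v0 s0 al0 sal hom theta X0.
(* In [2^(b + 3)], a factor 4 comes from the dilation [4K], a 2 from rounding in [K] and [2^b] from
   [m <= 2 Q^v]. *)
pose C : R := 2 ^+ (b + 3).
have C1 : 1 <= C by rewrite exprn_ege1 ?ler1n.
have C0 : 0 < C by exact: lt_le_trans C1.
pose e := v + a%:R - b%:R * v - s * al.
have e0 : 0 < e by rewrite subr_gt0.
have [N1 hN1] := powR_unbounded (C `^ (1 + s)) e0.
have [N2 hN2] := powR_unbounded (`|X0| + 1) al0.
(* [N1] lets the spare power [Q^e] absorb the constants, [N2] puts [X] beyond [X0] and 1, and the
   last term puts [Q] beyond [Q1]. *)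
pose Q := (N1 + N2 + (Num.trunc Q1).+1)%N.
have hQ1 : Q1 < Q%:R.
  by apply: lt_le_trans (truncnS_gt _) _; rewrite ler_nat leq_addl.
have {}hN1 : C `^ (1 + s) < Q%:R `^ e by apply: hN1; rewrite /Q; lia.
have {}hN2 : `|X0| + 1 < Q%:R `^ al by apply: hN2; rewrite /Q; lia.
have Q0 : (0 < Q)%N by rewrite /Q; lia.
have {}hom := hom Q hQ1.
have x1 : 1 <= Q%:R :> R by rewrite ler1n.
have x0 : 0 < Q%:R :> R by rewrite ltr0n.
have xn0 : Q%:R != 0 :> R by rewrite gt_eqF.
clearbody Q.
(* Rounding up gives [1/m < Q^(-v)], so [hom] passes to [m]; as [v >= 0], it loses at most a factor
   2. *)
pose m := (Num.trunc (Q%:R `^ v : R)).+1.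
have xv0 : 0 < Q%:R `^ v :> R by rewrite powR_gt0.
have xv1 : 1 <= Q%:R `^ v :> R by have := ler_powR x1 v0; rewrite powRr0.
have mlb : Q%:R `^ v < m%:R :> R by exact: truncnS_gt.
have mub : m%:R <= 2 * Q%:R `^ v :> R.
  have /andP[h _] := truncn_itv (powR_ge0 (Q%:R : R) v).
  rewrite /m -natr1; lra.
have m0 : (0 < m)%N by [].
have m0R : 0 < m%:R :> R by rewrite ltr0n.
have {}hom (q : 'rV[int]_a) : q != 0 -> (forall i, `|(q ord0 i)%:~R : R| < Q%:R) ->
     exists j, m%:R^-1 <= `|centered ((map_mx intr q *m A) ord0 j)|.
  move=> qn0 hq; have [j hj] := hom q qn0 hq; exists j.
  by rewrite (le_trans _ hj)// powRN lef_pV2// ltW.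
(* Otherwise Dirichlet's theorem would contradict [hom]. Hence the successor in [K], needed for a
   strict inequality, at most doubles [m^b / Q^a]. *)
have Qam : (Q ^ a <= m ^ b)%N.
  rewrite leqNgt; apply/negP => /(exists_small_multiple A m0)[q [qn0 hq hy]].
  have [j] := hom q qn0 hq; by rewrite leNgt hy.
pose K := (m ^ b %/ Q ^ a).+1.
have Qa0 : (0 < Q ^ a)%N by rewrite expn_gt0 Q0.
have mKQ : (m ^ b < K * Q ^ a)%N by rewrite ltn_ceil.
have KQ : (K * Q ^ a <= 2 * m ^ b)%N.
  by rewrite /K mulSn mul2n -addnn leq_add// leq_trunc_div.
have [q [qn0 hq hy]] := inhomogeneous_box_neq0 a0 m0 (isT : (0 < K)%N) Q0 mKQ hom theta.
pose X := C * Q%:R `^ al.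
have KX : (4 * K)%:R * Q%:R <= X.
  rewrite -(ler_pM2r (exprn_gt0 a x0)).
  have -> : X * Q%:R ^+ a = 4 * (2 * (2 * Q%:R `^ v) ^+ b) * Q%:R.
    rewrite /X /C -mulrA -(powR_mulrn a (ltW x0)) -powRD; last by rewrite xn0 implybT.
    have -> : al + a%:R = v * b%:R + 1 by rewrite /al; ring.
    rewrite powRD ?xn0 ?implybT// powRr1 ?(ltW x0)// powRrM.
    by rewrite powR_mulrn ?powR_ge0// exprMn exprD; ring.
  have h : K%:R * Q%:R ^+ a <= 2 * (2 * Q%:R `^ v) ^+ b.
    rewrite (@le_trans _ _ ((2 * m ^ b)%:R))//.
      by rewrite -natrX -natrM ler_nat.
    have h2 : 0 <= 2 * Q%:R `^ v :> R by apply: mulr_ge0 => //; exact: ltW.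
    by rewrite natrM natrX ler_pM2l//; apply: lerXn2r; rewrite ?nnegrE ?ler0n.
  have := ler_wpM2r (ltW x0) h.
  move: (_ ^+ a) ((_ * _) ^+ b) => y z; rewrite natrM; lra.
have X0lt : `|X0| + 1 < X by rewrite (lt_le_trans hN2)// ler_peMl// ltW// powR_gt0.
have Xpos : 0 < X by rewrite (le_lt_trans _ X0lt)// addr_ge0.
exists X; split.
- by rewrite (le_lt_trans _ X0lt)// (le_trans (ler_norm _))// lerDl.
- by rewrite (le_lt_trans _ X0lt)// lerDr.
exists q; split=> // [i|j].
  by rewrite (le_trans (ltW (hq i))).
rewrite (lt_le_trans (hy j))// ler_pdivrMr//.
rewrite (@le_trans _ _ (X `^ (- s) * Q%:R `^ v))//; last first.
  by rewrite ler_wpM2l ?powR_ge0// ltW.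
(* Bounding [4KQ] by [X] leaves [X^(1 + s) <= Q^(v + 1)], which is [C^(1 + s) <= Q^e] times
   [Q^(al (1 + s))]. *)
rewrite -(ler_pM2r x0) (le_trans KX)// powRN -mulrA ler_pdivlMl ?powR_gt0//.
rewrite -{2}(powRr1 (ltW Xpos)) -powRD; last by rewrite (gt_eqF Xpos) implybT.
rewrite -{2}(powRr1 (ltW x0)) -powRD; last by rewrite xn0 implybT.
have -> : v + 1 = e + al * (1 + s) by rewrite /e /al; ring.
rewrite [leRHS]powRD ?xn0 ?implybT// /X [s + 1]addrC powRM ?(ltW C0) ?powR_ge0// -powRrM.
by rewrite ler_pM2r ?powR_gt0// ltW.
Qed.

(** * Null sets of Lebesgue outer measure *)

Lemma box_volume_ge0 (R : realType) d (a b : 'rV[R]_d) : 0 <= box_volume a b.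
Proof. by apply: prodr_ge0 => j _; rewrite le_max lexx. Qed.

Lemma lebesgue_rV_ge0 (R : realType) d (A : set 'rV[R]_d) :
  (0 <= lebesgue_rV A)%E.
Proof.
apply: le_ereal_inf_tmp => _ [c _ <-]; apply: nneseries_ge0 => k _ _.
by rewrite lee_fin box_volume_ge0.
Qed.

Lemma lebesgue_rV_eq0 (R : realType) d (A B : set 'rV[R]_d) :
  A `<=` B -> lebesgue_rV B = 0%E -> lebesgue_rV A = 0%E.
Proof.
move=> AB B0; apply/eqP; rewrite eq_le lebesgue_rV_ge0 andbT -B0.
by apply: ereal_inf_le_tmp => _ [c cB <-]; exists c => //; exact: subset_trans cB.
Qed.

(** The cover uses degenerate boxes; in dimension 0 these would have volume 1, an empty product. *)
Lemma lebesgue_rV0 (R : realType) d : (0 < d)%N ->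
  lebesgue_rV (set0 : set 'rV[R]_d) = 0%E.
Proof.
move=> d0; apply/eqP; rewrite eq_le lebesgue_rV_ge0 andbT.
apply: ereal_inf_lbound; exists (fun=> (0, 0)) => //.
rewrite eseries0// => k _ _; congr (_%:E).
by rewrite /box_volume; case: d d0 => // d _; rewrite big_ord_recl subrr maxxx mul0r.
Qed.

(** Cover [A n] by boxes of total volume at most [e / 2^(n+1)] and enumerate all of them through a
    bijection of [nat] with [nat * nat]. *)
Lemma lebesgue_rV_bigcup_eq0 (R : realType) d (A : (set 'rV[R]_d)^nat) :
  (forall n, lebesgue_rV (A n) = 0%E) -> lebesgue_rV (\bigcup_n A n) = 0%E.
Proof.
move=> A0; apply/eqP; rewrite eq_le lebesgue_rV_ge0 andbT.
apply/lee_addgt0Pr => e e0; rewrite add0e.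
pose vol (c : 'rV[R]_d * 'rV[R]_d) := (box_volume c.1 c.2)%:E.
have vol_ge0 c : (0 <= vol c)%E by rewrite lee_fin box_volume_ge0.
have /choice[G PG] : forall n, exists c : nat -> 'rV[R]_d * 'rV[R]_d,
    A n `<=` \bigcup_k box (c k).1 (c k).2 /\
    (\sum_(0 <= k <oo) vol (c k) <= (e / (2 ^ n.+1)%:R)%:E)%E.
  move=> n; have en1 : 0 < e / (2 ^ n.+1)%:R by rewrite divr_gt0 ?ltr0n ?expn_gt0.
  have /(lb_ereal_inf_adherent en1)[_ [c Ac <-]] : lebesgue_rV (A n) \is a fin_num.
    by rewrite A0.
  have /= := A0 n; rewrite /lebesgue_rV => ->; rewrite add0e => /ltW h.
  by exists c.
apply: le_trans (epsilon_trick0 xpredT (ltW e0)).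
apply: (@le_trans _ _ (\esum_(i in setT) (vol \o uncurry G) i)%E).
  apply: ereal_inf_lbound.
  have /card_esym/ppcard_eqP[f] := card_nat2.
  exists (uncurry G \o f).
    move=> t [n _ /(PG n).1[k _ Bt]]; exists (f^-1%FUN (n, k)) => //=.
    by rewrite invK ?inE.
  rewrite -(esum_pred_image (vol \o uncurry G) _ xpredT) ?[fun=> _]set_true//.
    by rewrite image_eq.
  by move=> n _; exact: vol_ge0.
(* The terms are nonnegative, so the sum over pairs is an iterated series. *)
rewrite (_ : esum _ _ = \sum_(i <oo) \sum_(j <oo ) vol (G i j))%E; last first.
  pose J : nat -> set (nat * nat) := fun i => [set (i, j) | j in setT].
  rewrite (_ : setT = \bigcup_k J k); last first.
    by rewrite predeqE => -[i j]; split => // _; exists i => //; exists j.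
  rewrite esum_bigcupT /=; last 2 first.
    - apply/trivIsetP => i j _ _ ij.
      rewrite predeqE => -[n m] /=; split => //= -[] [_] _ [<-{n} _].
      by move=> [m' _] [] /esym/eqP; rewrite (negbTE ij).
    - by move=> /= [n m]; exact: vol_ge0.
  rewrite -(image_id [set: nat]) -fun_true esum_pred_image//; last first.
    by move=> n _; apply: esum_ge0 => x _; exact: vol_ge0.
  apply: eq_eseriesr => /= j _.
  rewrite -(esum_pred_image (vol \o uncurry G) (pair j) predT)//=; last first.
    by move=> ? ? _ _; exact: (@can_inj _ _ _ snd).
  by congr esum; rewrite predeqE => -[i k]; split; move=> [n _ <-]; exists n.
by apply: lee_nneseries => [n _ _|n _]; [apply: nneseries_ge0 => k _ _; exact: vol_ge0|exact: (PG n).2].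
Qed.

Lemma ae_le_manifold_exponent (R : realType) d n (U : set 'rV[R]_d)
    (f : 'rV[R]_d -> 'rV[R]_n) (omega : 'rV[R]_n -> \bar R) (P : 'rV[R]_n -> Prop) :
  (0 < d)%N ->
  (forall x, (omega x <= manifold_exponent (param_measure U f) omega)%E -> P x) ->
  almost_every (param_measure U f) P.
Proof.
move=> d0; set w := manifold_exponent _ _ => wP.
have null v : (w < v%:E)%E -> param_measure U f [set x | (v%:E < omega x)%E] = 0%E.
  move=> wv; apply/eqP; rewrite eq_le lebesgue_rV_ge0 andbT leNgt.
  apply/negP => pos; move: wv; rewrite ltNge => /negP; apply.
  by apply: ereal_sup_ubound; exists v.
(* A sequence of reals above [w] with infimum [w]. If [w = +oo], nothing exceeds it: [N k] is empty
   and the value of [v] is a mere default. *)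
pose v (k : nat) := if w is r%:E then r + k.+1%:R^-1 else - k%:R.
pose N k := if w == +oo%E then set0 else [set x | ((v k)%:E < omega x)%E].
rewrite /almost_every /param_measure.
apply: (@lebesgue_rV_eq0 _ _ _ (\bigcup_k (U `&` f @^-1` N k))); last first.
  apply: lebesgue_rV_bigcup_eq0 => k; rewrite /N; case: eqP => wy.
    by rewrite preimage_set0 setI0 lebesgue_rV0.
  by apply: null; rewrite /v; move: wy; case: (w) => // [r _|_]; rewrite ?ltNyr// lte_fin ltrDl.
move=> u [Uu /= nP]; have {nP} : (w < omega (f u))%E.
  by rewrite ltNge; apply/negP => /wP.
rewrite /N /v; case: (w) => [r||] /=; case ou: (omega (f u)) => [t||] // wo.
- exists (Num.trunc (t - r)^-1) => //; split=> //=.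
  move: wo; rewrite ou !lte_fin => rt.
  by rewrite -ltrBrDl invf_plt ?posrE ?subr_gt0// truncnS_gt.
- by exists 0%N => //; split=> //=; rewrite ou ltry.
- exists (Num.trunc (- t)).+1 => //; split=> //=.
  by rewrite ou lte_fin ltrNl truncnS_gt.
- by exists 0%N => //; split=> //=; rewrite ou ltry.
Qed.

(** * Lower bounds for the two inhomogeneous exponents *)

Lemma normr_centered_lt1 (R : realType) (y : R) : `|centered y| < 1.
Proof. by have /andP[] := centered_itv y; rewrite ltr_norml => *; lra. Qed.

Lemma prod_lt_exprn (R : realType) (n : nat) (F : 'I_n -> R) (c : R) : (0 < n)%N ->
  (forall j, 0 <= F j < c) -> \prod_(j < n) F j < c ^+ n.
Proof.
move=> n0 Fc; rewrite -[n in ltRHS]card_ord -prodr_const.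
by apply: ltr_prod => //; apply/hasP; exists (Ordinal n0); rewrite ?mem_index_enum.
Qed.

(** The value [w = 0] is always admissible, with [q = 1], because [n > 0] factors below 1 have
    product below 1. So the supremum is not over an empty set. *)
Lemma omega0_ge0 (R : realType) n (x theta : 'rV[R]_n) : (0 < n)%N ->
  (0 <= omega0 x theta)%E.
Proof.
move=> n0; apply: ereal_sup_ubound; exists 0 => //; split=> // Q0.
have Q1 : 1 < Num.max 1 Q0 + 1 by rewrite ltr_pwDr// le_max lexx.
exists (Num.max 1 Q0 + 1); split => //.
  by rewrite ltr_pwDr// le_max lexx orbT.
exists 1; split=> //; last by rewrite normr1 maxxx ltW.
rewrite mulr0 oppr0 powRr0 -[ltRHS](expr1n R n); apply: prod_lt_exprn => // j.
by rewrite normr_ge0 normr_centered_lt1.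
Qed.

Lemma omega_dual_ge0 (R : realType) n (x : 'rV[R]_n) (theta : R) : (0 < n)%N ->
  (0 <= omega_dual x theta)%E.
Proof.
move=> n0; apply: ereal_sup_ubound; exists 0 => //; split=> // Q0.
have Q1 : 1 < Num.max 1 Q0 + 1 by rewrite ltr_pwDr// le_max lexx.
exists (Num.max 1 Q0 + 1); split => //.
  by rewrite ltr_pwDr// le_max lexx orbT.
exists (const_mx 1); split.
- by apply/eqP => /rowP/(_ (Ordinal n0)); rewrite !mxE.
- by rewrite oppr0 powRr0 normr_centered_lt1.
- rewrite big1 => [|i _]; last by rewrite mxE normr1 maxxx.
  by rewrite exprn_ege1// ltW.
Qed.

(** For [a = 1] and [b = n], [al = n v] and the condition on [s] becomes [v (n s + n - 1) < 1]. It
    is open in [v], and its form without division admits [w = 0]. *)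
Lemma omega0_ge (R : realType) n (x theta : 'rV[R]_n) (w s : R) : (0 < n)%N ->
  0 <= w -> 0 <= s -> w * (n%:R * s + n%:R - 1) < 1 ->
  (omega0 x 0 <= w%:E)%E -> (s%:E <= omega0 x theta)%E.
Proof.
move=> n0 w0 s0 wD xw.
have n1 : 1 <= n%:R :> R by rewrite ler1n.
(* The condition on v says s < (1 - (n - 1) v) / (n v). *)
have [v wv vD] : exists2 v, w < v & v * (n%:R * s + n%:R - 1) < 1.
  have : 0 <= n%:R * s + n%:R - 1 by rewrite -addrA addr_ge0 ?mulr_ge0 ?subr_ge0.
  move: (n%:R * s + n%:R - 1) wD => D wD D0.
  exists (w + (1 - w * D) / (D + 1)); first by rewrite ltrDl divr_gt0; lra.
  have : (1 - w * D) / (D + 1) * (D + 1) = 1 - w * D by rewrite divfK// gt_eqF//; lra.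
  have : 0 < (1 - w * D) / (D + 1) by rewrite divr_gt0; lra.
  rewrite mulrDl; lra.
have v0 : 0 < v by exact: le_lt_trans wv.
(* As [v] exceeds the exponent of [x], homogeneous solutions of quality [v] stop from some [Q1]
   on. *)
have [Q1 hQ1] : exists Q1 : R, forall Q : R, Q1 < Q -> 1 < Q ->
    forall q : int, q != 0 -> Num.max 1 `|q%:~R| <= Q ->
    Q `^ (- (n%:R * v)) <= \prod_(j < n) `|centered (q%:~R * x ord0 j)|.
  apply: contrapT => /forallNP noQ.
  suff : (v%:E <= w%:E)%E by rewrite lee_fin leNgt wv.
  apply: le_trans xw; apply: ereal_sup_ubound; exists v => //; split; first exact: ltW.
  move=> Q0; apply: contrapT => noQ'; apply: (noQ Q0) => Q Q0Q Q1 q q0 qQ.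
  rewrite leNgt; apply/negP => lt; apply: noQ'; exists Q; split=> //; exists q.
  by split=> //; under eq_bigr do rewrite mxE addr0.
apply: ereal_sup_ubound; exists s => //; split=> // X0.
have [|||X [X0X X1 [q [q0 qX qx]]]] :=
  @inhomogeneous_exponent R 1 n x v s (Num.max Q1 1) isT (ltW v0) s0 _ _ _ theta X0.
- by rewrite mulr1n subrK mulr_gt0//; lra.
- by rewrite mulr1n subrK; lra.
- move=> Q; rewrite gt_max => /andP[QQ1 Q1lt] q q0 qQ.
  apply: contrapT => /forallNP no.
  have q00 : q ord0 ord0 != 0.
    by apply: contraNneq q0 => q00; apply/eqP/rowP => i; rewrite (ord1 i) q00 mxE.
  have := hQ1 _ QQ1 Q1lt _ q00; rewrite ge_max (ltW Q1lt) (ltW (qQ ord0)) => /(_ isT).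
  rewrite leNgt => /negP; apply.
  (* If all [n] factors were below [Q^(-v)], their product would be below [Q^(-n v)]. *)
  rewrite -mulrN mulrC powRrM powR_mulrn ?powR_ge0//.
  apply: prod_lt_exprn => // j; rewrite normr_ge0 /= ltNge.
  by apply/negP => h; apply: (no j); rewrite mxE big_ord1 mxE.
exists X; split=> //; exists (q ord0 ord0); split.
- by apply: contraNneq q0 => q00; apply/eqP/rowP => i; rewrite (ord1 i) q00 mxE.
- rewrite -mulrN mulrC powRrM powR_mulrn ?powR_ge0//.
  apply: prod_lt_exprn => // j; rewrite normr_ge0 /=.
  by have := qx j; rewrite !mxE big_ord1 mxE.
- by rewrite ge_max (ltW X1) qX.
Qed.

(** For [a = n] and [b = 1], [al = v - (n - 1)] and the condition on [s] becomes
    [s (v - (n - 1)) < n]. *)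
Lemma omega_dual_ge (R : realType) n (x : 'rV[R]_n) (theta w s : R) : (0 < n)%N ->
  0 <= s -> s * (w - (n%:R - 1)) < n%:R ->
  (omega_dual x 0 <= w%:E)%E -> (s%:E <= omega_dual x theta)%E.
Proof.
move=> n0 s0 sw xw.
have n1 : 1 <= n%:R :> R by rewrite ler1n.
have [v [wv nv vs]] : exists v, [/\ w < v, n%:R - 1 < v & s * (v - (n%:R - 1)) < n%:R].
  (* The maximum serves [al > 0], and [e] is small enough that [s * e] stays below the gap left at
     [g]. *)
  pose g := Num.max w (n%:R - 1); pose e := (n%:R - s * (g - (n%:R - 1))) / (s + 1).
  have sg : s * (g - (n%:R - 1)) < n%:R.
    by rewrite /g; case: (leP w (n%:R - 1)) => // _; rewrite subrr mulr0; lra.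
  have e0 : 0 < e by rewrite divr_gt0; lra.
  exists (g + e); split.
  - by rewrite (@le_lt_trans _ _ g) ?ltrDl// le_max lexx.
  - by rewrite (@le_lt_trans _ _ g) ?ltrDl// le_max lexx orbT.
  - have : e * (s + 1) = n%:R - s * (g - (n%:R - 1)) by rewrite divfK// gt_eqF//; lra.
    rewrite !mulrBr mulrDr; lra.
have v0 : 0 <= v by rewrite (le_trans _ (ltW nv))// subr_ge0.
have [Q1 hQ1] : exists Q1 : R, forall Q : R, Q1 < Q -> 1 < Q ->
    forall q : 'rV[int]_n, q != 0 ->
    \prod_(i < n) Num.max 1 `|(q ord0 i)%:~R| <= Q ^+ n ->
    Q `^ (- v) <= `|centered (dot (map_mx intr q) x)|.
  apply: contrapT => /forallNP noQ.
  suff : (v%:E <= w%:E)%E by rewrite lee_fin leNgt wv.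
  apply: le_trans xw; apply: ereal_sup_ubound; exists v => //; split=> //.
  move=> Q0; apply: contrapT => noQ'; apply: (noQ Q0) => Q Q0Q Q1 q q0 qQ.
  rewrite leNgt; apply/negP => lt; apply: noQ'; exists Q; split=> //; exists q.
  by rewrite addr0; split.
have dotE (q : 'rV[int]_n) : (map_mx intr q *m x^T) ord0 ord0 = dot (map_mx intr q) x.
  by rewrite mxE; apply: eq_bigr => i _; rewrite [x^T _ _]mxE.
have prod_le (Q : R) (q : 'rV[int]_n) : 1 < Q -> (forall i, `|(q ord0 i)%:~R : R| <= Q) ->
    \prod_(i < n) Num.max 1 `|(q ord0 i)%:~R| <= Q ^+ n.
  move=> Q1lt qQ; rewrite -[n in leRHS]card_ord -prodr_const.
  by apply: ler_prod => i _; rewrite ge_max le_max ler01 (ltW Q1lt) qQ.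
apply: ereal_sup_ubound; exists s => //; split=> // X0.
have [|||X [X0X X1 [q [q0 qX qx]]]] :=
  @inhomogeneous_exponent R n 1 x^T v s (Num.max Q1 1) n0 v0 s0 _ _ _ (const_mx theta) X0.
- by rewrite mul1r; lra.
- by rewrite !mul1r; lra.
- move=> Q; rewrite gt_max => /andP[QQ1 Q1lt] q q0 qQ; exists ord0.
  by rewrite dotE; apply: hQ1 => //; apply: prod_le => // i; exact: ltW.
exists X; split=> //; exists q; split=> //; last exact: prod_le.
by have := qx ord0; rewrite [(_ + const_mx _)%R _ _]mxE dotE mxE.
Qed.

(** * Transference at a single point, with values in the extended reals *)

Lemma lee_ge0_dense (R : realType) (z : \bar R) (r : R) : (0 <= z)%E ->
  (forall s, 0 <= s -> s < r -> (s%:E <= z)%E) -> (r%:E <= z)%E.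
Proof.
case: z => [z|_ _|]; [|by rewrite leey|by []].
rewrite !lee_fin => z0 h; rewrite leNgt; apply/negP => zr.
have : (((z + r) / 2)%:E <= z%:E)%E by apply: h; lra.
by rewrite lee_fin; lra.
Qed.

Lemma lee_ge0_pinfty (R : realType) (z : \bar R) : (0 <= z)%E ->
  (forall s, 0 <= s -> (s%:E <= z)%E) -> (+oo <= z)%E.
Proof.
case: z => [z||] //; rewrite lee_fin => z0 h.
exfalso; have : ((z + 1)%:E <= z%:E)%E by apply: h; lra.
by rewrite lee_fin; lra.
Qed.

(** The inverses of 0 and [+oo] being [+oo] and 0, the bound is [+oo] for [w = 0], where every [s]
    is reached, and 0 for [w = +oo]. *)
Lemma omega0_transference (R : realType) n (x theta : 'rV[R]_n) (w : \bar R) :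
  (0 < n)%N -> (omega0 x 0 <= w)%E ->
  ((1 - (n%:R - 1)%:E * w) / (n%:R%:E * w) <= omega0 x theta)%E.
Proof.
move=> n0; have n1 : 0 < n%:R :> R by rewrite ltr0n.
have ge0 := omega0_ge0 x theta n0.
case: w => [w||] xw; last first.
- by have := le_trans (omega0_ge0 x 0 n0) xw.
- by rewrite [(n%:R%:E * _)%E]gt0_muley ?lte_fin// invey mule0.
have := le_trans (omega0_ge0 x 0 n0) xw; rewrite lee_fin le_eqVlt => /predU1P[w0|w0].
  subst w; rewrite !mule0 oppe0 adde0 mul1e inve0.
  by apply: lee_ge0_pinfty => // s s0; apply: omega0_ge xw; rewrite ?mul0r.
rewrite -!EFinM -EFinB inver gt_eqF ?mulr_gt0// -EFinM.
apply: lee_ge0_dense => // s s0; rewrite ltr_pdivlMr ?mulr_gt0// => h.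
by apply: omega0_ge xw => //; [exact: ltW | lra].
Qed.

Lemma omega_dual_transference (R : realType) n (x : 'rV[R]_n) (theta : R) (w : \bar R) :
  (0 < n)%N -> (omega_dual x 0 <= w)%E ->
  (n%:R%:E / (w - (n%:R - 1)%:E) <= omega_dual x theta)%E.
Proof.
move=> n0; have n1 : 0 < n%:R :> R by rewrite ltr0n.
have ge0 := omega_dual_ge0 x theta n0.
case: w => [w||] xw; last first.
- by have := le_trans (omega_dual_ge0 x 0 n0) xw.
- by rewrite addye// invey mule0.
rewrite -EFinB inver; case: eqP => [wn|/eqP wn].
  rewrite gt0_muley ?lte_fin//; apply: lee_ge0_pinfty => // s s0.
  by apply: omega_dual_ge xw => //; rewrite wn mulr0.
rewrite -EFinM; apply: lee_ge0_dense => // s s0 h.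
apply: omega_dual_ge xw => //.
(* For [w < n - 1] the left side is nonpositive, hence below [n]. *)
have [wn0|wn0] := ltP 0 (w - (n%:R - 1)); first by rewrite -ltr_pdivlMr.
by rewrite (le_lt_trans _ n1)// mulr_ge0_le0.
Qed.

Theorem theorem2p6 (R : realType) (d n : nat) (hd : (0 < d)%N)
    (U : set 'rV[R]_d) (f : 'rV[R]_d -> 'rV[R]_n)
    (hM : parametrises_submanifold U f)
    (hT : almost_every (param_measure U f)
            (fun x => forall j : 'I_n,
               ~ orthogonal_to_axis (tangent_plane U f x) j)) :
  (forall theta : 'rV[R]_n, almost_every (param_measure U f) (fun x =>
     let w := manifold_exponent (param_measure U f) (fun y => omega0 y 0) in
     ((1 - (n%:R - 1)%:E * w) / (n%:R%:E * w) <= omega0 x theta)%E)) /\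
  (forall theta : R, almost_every (param_measure U f) (fun x =>
     let w := manifold_exponent (param_measure U f) (fun y => omega_dual y 0) in
     (n%:R%:E / (w - (n%:R - 1)%:E) <= omega_dual x theta)%E)).
Proof.
have [n0|n0] := posnP n; last first.
  split=> theta.
    apply: (@ae_le_manifold_exponent _ _ _ _ _ (fun y => omega0 y 0)) => // x.
    exact: omega0_transference.
  apply: (@ae_le_manifold_exponent _ _ _ _ _ (fun y => omega_dual y 0)) => // x.
  exact: omega_dual_transference.
(* When n = 0 < d, no map into R^0 is an immersion, so U is empty. *)
have U0 u : ~ U u.
  move=> Uu; case: hM => _ _ /(_ u Uu) inj _ _.
  have /inj/rowP/(_ (Ordinal hd)) : 'd f u (const_mx 1) = 'd f u 0.
    by apply/rowP => j; have := ltn_ord j; rewrite [in ltnRHS]n0.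
  by rewrite !mxE => /eqP; rewrite oner_eq0.
have null P : almost_every (param_measure U f) P.
  rewrite /almost_every /param_measure.
  by apply: lebesgue_rV_eq0 (lebesgue_rV0 R hd) => u [/U0].
by split=> theta; exact: null.
Qed.
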